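(* Let $(\mathrm{A},\mathrm{A}',(\mathcal{S}_\tau)_{\tau\in\mathbb{R}},u)$ be a collision model and let $\sigma\in\mathsf{St}_1(\mathrm{A}')$ be any reference state. For $\tau\in\mathbb{R}$ put $\mathcal{C}_{\tau,\sigma}:=(\mathcal{I}_{\mathrm{A}}\otimes u)\circ\mathcal{S}_\tau\circ(\mathcal{I}_{\mathrm{A}}\otimes\sigma)\in\mathsf{Transf}(\mathrm{A}\to\mathrm{A})$ and $\mathcal{U}_{t,\sigma}:=\lim_{n\to\infty}(\mathcal{C}_{t/n,\sigma})^n$. Then for every $t$ the limit exists, $(\mathcal{U}_{t,\sigma})_{t\in\mathbb{R}}$ is a one-parameter subgroup of the Lie group $\mathsf{G}_{\mathrm{A}}$ of reversible transformations of $\mathrm{A}$, and $\mathcal{U}_{t,\sigma}=e^{G_\sigma t}$, where $G_\sigma:=(\mathcal{I}_{\mathrm{A}}\otimes u)\,\frac{\mathrm d\mathcal{S}_\tau}{\mathrm d\tau}\big|_{\tau=0}\,(\mathcal{I}_{\mathrm{A}}\otimes\sigma)$, i.e. $G_\sigma(\rho)=(\mathcal{I}_{\mathrm{A}}\otimes u)\frac{\mathrm d\mathcal{S}_\tau}{\mathrm d\tau}\big|_{\tau=0}(\rho\otimes\sigma)$.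
   Context: Setting: an operational probabilistic theory (OPT). There is a collection of systems, closed under a composition $\otimes$, with a trivial system $\mathrm{I}$ satisfying $\mathrm{A}\otimes\mathrm{I}=\mathrm{I}\otimes\mathrm{A}=\mathrm{A}$. For systems $\mathrm{A},\mathrm{B}$ there is a set $\mathsf{Transf}(\mathrm{A}\to\mathrm{B})$ of transformations, closed under sequential composition $\circ$ and parallel composition $\otimes$, containing identities $\mathcal{I}_{\mathrm{A}}$. Tests are finite collections of transformations (experiments with outcomes); the set of tests is closed under parallel/sequential composition and coarse-graining (summing transformations over a partition of outcomes). A transformation is deterministic if it forms a single-outcome test. States are $\mathsf{St}(\mathrm{A})=\mathsf{Transf}(\mathrm{I}\to\mathrm{A})$, effects $\mathsf{Eff}(\mathrm{A})=\mathsf{Transf}(\mathrm{A}\to\mathrm{I})$, and $\mathsf{St}_1,\mathsf{Eff}_1$ denote the deterministic ones; transformations $\mathrm{I}\to\mathrm{I}$ are identified with probabilities, and two transformations are identified if they give the same probabilities in all circuits. Each $\mathcal{T}\in\mathsf{Transf}(\mathrm{A}\to\mathrm{B})$ is identified with the family of linear maps induced by $\mathcal{T}\otimes\mathcal{I}_{\mathrm{E}}$ from $\mathsf{St}_{\mathbb{R}}(\mathrm{A}\otimes\mathrm{E})$ to $\mathsf{St}_{\mathbb{R}}(\mathrm{B}\otimes\mathrm{E})$ over all systems $\mathrm{E}$ ($\mathsf{St}_{\mathbb{R}}$ = real span of states), and these span a real vector space $\mathsf{Transf}_{\mathbb{R}}(\mathrm{A}\to\mathrm{B})$. Standing assumption: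 each $\mathsf{Transf}_{\mathbb{R}}(\mathrm{A}\to\mathrm{B})$ is finite-dimensional and $\mathsf{Transf}(\mathrm{A}\to\mathrm{B})$ is convex and closed in the operational norm (for states $\|\xi\|=\sup_{a\in\mathsf{Eff}}a(\xi)-\inf_{b\in\mathsf{Eff}}b(\xi)$; for transformations $\|\mathcal{T}\|_{op}=\sup_{\mathrm{E}}\sup_{\rho\in\mathsf{St}(\mathrm{A}\otimes\mathrm{E}),\|\rho\|\neq0}\|(\mathcal{T}\otimes\mathcal{I}_{\mathrm{E}})\rho\|/\|\rho\|$). A transformation is reversible if it has a two-sided inverse transformation; the reversible transformations $\mathrm{A}\to\mathrm{A}$ form a group $\mathsf{G}_{\mathrm{A}}$, which under these assumptions is a compact Lie group with a faithful finite-dimensional matrix representation, so derivatives of one-parameter subgroups are well-defined; $\mathfrak{g}_{\mathrm{A}}$ is its Lie algebra. A collision model is a tuple $(\mathrm{A},\mathrm{A}',(\mathcal{S}_\tau)_{\tau\in\mathbb{R}},u)$ with systems $\mathrm{A}$ (target) and $\mathrm{A}'$ (reference), a one-parameter subgroup $(\mathcal{S}_\tau)$ of $\mathsf{G}_{\mathrm{A}\otimes\mathrm{A}'}$, and a deterministic effect $u\in\mathsf{Eff}_1(\mathrm{A}')$. *)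

(* Defs.v *)
From HB Require Import structures.
From mathcomp Require Import all_boot all_order all_algebra.
From mathcomp Require Import all_classical all_reals all_analysis.
Set Implicit Arguments.
Unset Strict Implicit.
Unset Printing Implicit Defensive.
Import Order.TTheory GRing.Theory Num.Theory.
Import numFieldNormedType.Exports.
Local Open Scope classical_set_scope.
Local Open Scope ring_scope.

(* An operational probabilistic theory satisfying the standing assumptions,
   presented through its linearization: Transf_R(A -> B) is a finite-dimensional
   real vector space, represented by coordinates 'rV[R]_(dimT A B) (any norm on
   a finite-dimensional space induces the same topology as the operational norm).
   Transf(A -> B) is a subset of it; sequential and parallel composition are
   bilinear (they are the linear extensions of the OPT compositions). *)
Record OPT (R : realType) : Type := {
  sys : Type;
  tens : sys -> sys -> sys;
  triv : sys;
  tens_trivl : forall A, tens triv A = A;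
  tens_trivr : forall A, tens A triv = A;
  tens_assoc : forall A B C, tens (tens A B) C = tens A (tens B C);
  dimT : sys -> sys -> nat;
  compT : forall A B C, 'rV[R]_(dimT B C) -> 'rV[R]_(dimT A B) -> 'rV[R]_(dimT A C);
  parT : forall A B C D, 'rV[R]_(dimT A B) -> 'rV[R]_(dimT C D) ->
           'rV[R]_(dimT (tens A C) (tens B D));
  idT : forall A, 'rV[R]_(dimT A A);
  transf : forall A B, set 'rV[R]_(dimT A B);
  tests : forall A B, set (seq 'rV[R]_(dimT A B));
  prob : 'rV[R]_(dimT triv triv) -> R;
  compTA : forall A B C D (h : 'rV_(dimT C D)) (g : 'rV_(dimT B C)) (f : 'rV_(dimT A B)),
      compT h (compT g f) = compT (compT h g) f;
  compT_idl : forall A B (f : 'rV_(dimT A B)), compT (idT B) f = f;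
  compT_idr : forall A B (f : 'rV_(dimT A B)), compT f (idT A) = f;
  compT_linl : forall A B C (a : R) (x y : 'rV_(dimT B C)) (z : 'rV_(dimT A B)),
      compT (a *: x + y) z = a *: compT x z + compT y z;
  compT_linr : forall A B C (a : R) (z : 'rV_(dimT B C)) (x y : 'rV_(dimT A B)),
      compT z (a *: x + y) = a *: compT z x + compT z y;
  parT_linl : forall A B C D (a : R) (x y : 'rV_(dimT A B)) (z : 'rV_(dimT C D)),
      parT (a *: x + y) z = a *: parT x z + parT y z;
  parT_linr : forall A B C D (a : R) (z : 'rV_(dimT A B)) (x y : 'rV_(dimT C D)),
      parT z (a *: x + y) = a *: parT z x + parT z y;
  parT_comp : forall A B C A' B' C' (f : 'rV_(dimT B C)) (f' : 'rV_(dimT A B))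
      (g : 'rV_(dimT B' C')) (g' : 'rV_(dimT A' B')),
      compT (parT f g) (parT f' g') = parT (compT f f') (compT g g');
  parT_id : forall A C, parT (idT A) (idT C) = idT (tens A C);
  parT_trivr : forall A B (f : 'rV_(dimT A B)),
      castmx (erefl 1%N, congr2 dimT (tens_trivr A) (tens_trivr B))
        (parT f (idT triv)) = f;
  parT_trivl : forall A B (f : 'rV_(dimT A B)),
      castmx (erefl 1%N, congr2 dimT (tens_trivl A) (tens_trivl B))
        (parT (idT triv) f) = f;
  parT_assoc : forall A B C A' B' C' (f : 'rV_(dimT A A')) (g : 'rV_(dimT B B'))
      (h : 'rV_(dimT C C')),
      castmx (erefl 1%N, congr2 dimT (tens_assoc A B C) (tens_assoc A' B' C'))
        (parT (parT f g) h) = parT f (parT g h);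
  prob_lin : forall (a : R) (x y : 'rV_(dimT triv triv)),
      prob (a *: x + y) = a * prob x + prob y;
  prob_inj : injective prob;
  prob_id : prob (idT triv) = 1;
  prob_comp : forall p q, prob (compT p q) = prob p * prob q;
  transf_span : forall A B (x : 'rV_(dimT A B)),
      exists s : seq (R * 'rV_(dimT A B)),
        (forall p, p \in s -> @transf A B p.2) /\ x = \sum_(p <- s) p.1 *: p.2;
  transf_id : forall A, @transf A A (idT A);
  transf_comp : forall A B C (g : 'rV_(dimT B C)) (f : 'rV_(dimT A B)),
      @transf B C g -> @transf A B f -> @transf A C (compT g f);
  transf_par : forall A B C D (f : 'rV_(dimT A B)) (g : 'rV_(dimT C D)),
      @transf A B f -> @transf C D g -> @transf (tens A C) (tens B D) (parT f g);
  transf_convex : forall A B (l : R) (x y : 'rV_(dimT A B)), 0 <= l -> l <= 1 ->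
      @transf A B x -> @transf A B y -> @transf A B (l *: x + (1 - l) *: y);
  transf_closed : forall A B, closed (@transf A B);
  transf_tests : forall A B (f : 'rV_(dimT A B)),
      @transf A B f <-> exists2 s, @tests A B s & f \in s;
  tests_id : forall A, @tests A A [:: idT A];
  tests_comp : forall A B C (s : seq 'rV_(dimT A B)) (s' : seq 'rV_(dimT B C)),
      @tests A B s -> @tests B C s' -> @tests A C [seq compT y x | x <- s, y <- s'];
  tests_par : forall A B C D (s : seq 'rV_(dimT A B)) (s' : seq 'rV_(dimT C D)),
      @tests A B s -> @tests C D s' ->
      @tests (tens A C) (tens B D) [seq parT x y | x <- s, y <- s'];
  tests_coarse : forall A B (s : seq 'rV_(dimT A B)) m (f : 'I_(size s) -> 'I_m),
      (forall j, exists i, f i = j) -> @tests A B s ->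
      @tests A B [seq \sum_(i | f i == j) s`_i | j <- enum 'I_m];
  tests_prob : forall s, @tests triv triv s ->
      (forall p, p \in s -> 0 <= prob p) /\ \sum_(p <- s) prob p = 1
}.

Arguments sys {R} o.
Arguments tens {R} o.
Arguments triv {R} o.
Arguments dimT {R} o.
Arguments compT {R} o {A B C}.
Arguments parT {R} o {A B C D}.
Arguments idT {R} o A.
Arguments transf {R} o A B.
Arguments tests {R} o A B.
Arguments prob {R} o.
Arguments tens_trivr {R} o A.

Section OPTdefs.
Context {R : realType} (O : OPT R).

Definition TR (A B : sys O) := 'rV[R]_(dimT O A B).
End OPTdefs.
Arguments TR {R} O A B.
Section OPTdefs2.
Context {R : realType} (O : OPT R).

Definition deterministic A B (T : TR O A B) : Prop := tests O A B [:: T].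

Definition state A (s : TR O (triv O) A) : Prop := transf O (triv O) A s.
Definition effect A (e : TR O A (triv O)) : Prop := transf O A (triv O) e.

Definition reversible A (T : TR O A A) : Prop :=
  transf O A A T /\ exists T', transf O A A T' /\
    compT O T T' = idT O A /\ compT O T' T = idT O A.

(* one-parameter subgroup of the Lie group G_A: a (differentiable, hence
   smooth) group homomorphism from (R,+) to G_A *)
Definition one_param_subgroup A (S : R -> TR O A A) : Prop :=
  (forall t, reversible (S t)) /\ S 0 = idT O A /\
  (forall s t, S (s + t) = compT O (S s) (S t)) /\
  (forall t, derivable S t 1).

Definition collision_model A A' (S : R -> TR O (tens O A A') (tens O A A'))
    (u : TR O A' (triv O)) : Prop :=
  one_param_subgroup S /\ effect u /\ deterministic u.

Definition attach_state A A' (sigma : TR O (triv O) A') : TR O A (tens O A A') :=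
  castmx (erefl 1%N, congr2 (dimT O) (tens_trivr O A) (erefl (tens O A A')))
    (parT O (idT O A) sigma).

Definition apply_effect A A' (u : TR O A' (triv O)) : TR O (tens O A A') A :=
  castmx (erefl 1%N, congr2 (dimT O) (erefl (tens O A A')) (tens_trivr O A))
    (parT O (idT O A) u).

Definition powT A (T : TR O A A) (n : nat) : TR O A A := iter n (compT O T) (idT O A).

Definition expT A (X : TR O A A) : TR O A A :=
  lim ((fun n => \sum_(k < n) (k`!%:R)^-1 *: powT X k) @ \oo).

End OPTdefs2.

(* Main.v *)
(** Let e be the identity of the algebra Transf_R(A -> A). Because u and sigma are
    deterministic, u sigma is the certain event, so C_0 = e, and differentiating
    at 0 gives n (C_(t/n) - e) --> t G. In an algebra with a bounded product this
    already forces C_(t/n)^n --> exp (t G): by telescoping, X_n^n - Y_n^n --> 0 as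
    soon as n (X_n - e) and n (Y_n - e) have the same limit, and
    (e + Y/n)^n --> exp Y because the difference with the exponential series is
    dominated termwise by its scalar counterpart. Applied to
    X_n = (e + X/n) (e + Y/n), the same criterion yields
    exp (X + Y) = exp X exp Y for commuting X and Y, hence the group law. Each limit
    is a transformation because Transf(A -> A) is closed, and U_(-t) inverts U_t. *)
Require Import Defs.
From HB Require Import structures.
From mathcomp Require Import all_boot all_order all_algebra.
From mathcomp Require Import all_classical all_reals all_analysis.
From mathcomp Require Import ring lra.
Set Implicit Arguments.
Unset Strict Implicit.
Unset Printing Implicit Defensive.
Import Order.TTheory GRing.Theory Num.Theory.
Import numFieldNormedType.Exports.
Local Open Scope classical_set_scope.
Local Open Scope ring_scope.

(** * Bounded bilinear maps *)

Section BoundedBilinear.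
Context {R : realType} {U V W : normedModType R} (B : U -> V -> W) (K : R).
Context (linl : forall a x y z, B (a *: x + y) z = a *: B x z + B y z).
Context (linr : forall a z x y, B z (a *: x + y) = a *: B z x + B z y).

Lemma bilin0l z : B 0 z = 0.
Proof. by have := linl (-1) 0 0 z; rewrite scaler0 add0r scaleN1r addNr. Qed.

Lemma bilin0r z : B z 0 = 0.
Proof. by have := linr (-1) z 0 0; rewrite scaler0 add0r scaleN1r addNr. Qed.

Lemma bilinZl a x z : B (a *: x) z = a *: B x z.
Proof. by have := linl a x 0 z; rewrite addr0 bilin0l addr0. Qed.

Lemma bilinZr a z x : B z (a *: x) = a *: B z x.
Proof. by have := linr a z x 0; rewrite addr0 bilin0r addr0. Qed.

Lemma bilinDl x y z : B (x + y) z = B x z + B y z.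
Proof. by have := linl 1 x y z; rewrite !scale1r. Qed.

Lemma bilinDr z x y : B z (x + y) = B z x + B z y.
Proof. by have := linr 1 z x y; rewrite !scale1r. Qed.

Lemma bilinBl x y z : B (x - y) z = B x z - B y z.
Proof. by rewrite -[- y]scaleN1r bilinDl bilinZl scaleN1r. Qed.

Lemma bilinBr z x y : B z (x - y) = B z x - B z y.
Proof. by rewrite -[- y]scaleN1r bilinDr bilinZr scaleN1r. Qed.

Lemma bilin_suml I (r : seq I) (F : I -> U) z :
  B (\sum_(i <- r) F i) z = \sum_(i <- r) B (F i) z.
Proof.
by elim: r => [|i r IH]; rewrite ?big_nil ?bilin0l// !big_cons bilinDl IH.
Qed.

Lemma bilin_sumr I (r : seq I) (F : I -> V) z :
  B z (\sum_(i <- r) F i) = \sum_(i <- r) B z (F i).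
Proof.
by elim: r => [|i r IH]; rewrite ?big_nil ?bilin0r// !big_cons bilinDr IH.
Qed.

Context (Bbound : forall x y, `|B x y| <= K * `|x| * `|y|).

(** The difference splits as [B (f t - x) (g t) + B x (g t - y)]; in the bound of each term one
    factor tends to 0 while the others converge. *)
Lemma cvg_bilin {T : Type} {F : set_system T} {FF : Filter F}
    (f : T -> U) (g : T -> V) x y :
  f @ F --> x -> g @ F --> y -> (fun t => B (f t) (g t)) @ F --> B x y.
Proof.
move=> fx gy; apply/subr_cvg0/norm_cvg0P.
apply: (@squeeze_cvgr _ _ _ _ (fun=> 0)
  (fun t => K * `|f t - x| * `|g t| + K * `|x| * `|g t - y|)); last 2 first.
- exact: cvg_cst.
- rewrite [X in _ --> X](_ : 0 = K * `|x - x| * `|y| + K * `|x| * `|y - y|); last first.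
    by rewrite !subrr !normr0 !mulr0 mul0r addr0.
  apply: cvgD; apply: cvgM; do ?[exact: cvg_cst | exact: cvg_norm].
  + by apply: cvgM; [exact: cvg_cst|apply: cvg_norm; apply: cvgB => //; exact: cvg_cst].
  + by apply: cvg_norm; apply: cvgB => //; exact: cvg_cst.
near=> t; rewrite normr_ge0/=.
have -> : B (f t) (g t) - B x y = B (f t - x) (g t) + B x (g t - y).
  by rewrite bilinBl bilinBr addrA subrK.
by rewrite (le_trans (ler_normD _ _))// lerD.
Unshelve. all: by end_near. Qed.

End BoundedBilinear.

(** * Scalar limits and derivatives along sequences *)

Lemma cvgn_inv {R : realType} : (fun n : nat => n%:R^-1 : R) @ \oo --> 0.
Proof. by rewrite -cvg_shiftS; exact: cvg_harmonic. Qed.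

Lemma cvgn_div {R : realType} (a : R) : (fun n : nat => a / n%:R) @ \oo --> 0.
Proof.
by rewrite -[0](mulr0 a); apply: cvgM; [exact: cvg_cst|exact: cvgn_inv].
Qed.

Lemma cvg_derive1_seq {R : realType} {V : normedModType R} (f : R -> V) (t : R) :
  derivable f 0 1 ->
  (fun n : nat => n%:R *: (f (t / n%:R) - f 0)) @ \oo --> t *: derive1 f 0.
Proof.
move=> df.
have [->|t0] := eqVneq t 0.
  by rewrite scale0r; under eq_fun do rewrite mul0r subrr scaler0; exact: cvg_cst.
(* The derivative is a limit along the punctured filter, so [t / n%:R] must avoid 0: this excludes
   [t = 0], treated apart, and [n = 0], where the inverse of 0 is 0. *)
have tn : (fun n : nat => t / n%:R) @ \oo --> 0^'.
  move=> A /(cvgn_div t) A0.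
  have {}A0 : \forall n \near \oo, t / n%:R != 0 -> A (t / n%:R) by exact: A0.
  suff : \forall n \near \oo, A (t / n%:R) by [].
  near=> n; have n0 : n%:R != 0 :> R.
    by rewrite pnatr_eq0 -lt0n; near: n; exact: nbhs_infty_gt.
  have : t / n%:R != 0 -> A (t / n%:R) by near: n.
  by apply; rewrite mulf_neq0// invr_neq0.
rewrite derive1E.
have := cvg_comp _ _ tn df.
move=> /(cvgZ (cvg_cst t)).
apply: cvg_trans.
apply: near_eq_cvg; near=> n; have n0 : n%:R != 0 :> R.
  by rewrite pnatr_eq0 -lt0n; near: n; exact: nbhs_infty_gt.
rewrite /= addr0 [_%:A]mulr1 scalerA invfM invrK.
by rewrite mulrA divff// mul1r.
Unshelve. all: by end_near. Qed.

(** Since [ln (1 + x)] has derivative 1 at 0, [n * ln (1 + b / n)] tends to [b]; then apply [expR].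
    The sign of [b] keeps the argument of [ln] positive for every [n]. *)
Lemma cvgn_pow1D_expR {R : realType} (b : R) : 0 <= b ->
  (fun n : nat => (1 + b / n%:R) ^+ n) @ \oo --> expR b.
Proof.
move=> b0.
have df : is_derive (0 : R) 1 (fun x => ln (1 + x)) 1.
  have dln : is_derive (1 + 0 : R) 1 (@ln R) 1.
    by have := @is_derive1_ln R (1 + 0); rewrite addr0 invr1; apply.
  have := is_deriveD (is_derive_cst (1 : R) (0 : R) 1) (is_derive_id (0 : R) 1).
  by move=> /(is_derive1_comp dln); rewrite add0r mulr1.
have := @cvg_derive1_seq R R _ b (@ex_derive _ _ _ _ _ _ _ df).
rewrite derive1E (@derive_val _ _ _ _ _ _ _ df) [_ *: _]mulr1 => /(cvg_comp _ _)/(_ (@continuous_expR R b)).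
apply: cvg_trans; apply: near_eq_cvg; near=> n => /=.
rewrite addr0 ln1 subr0 expRM_natl lnK// posrE.
by rewrite ltr_wpDr// divr_ge0.
Unshelve. all: by end_near. Qed.

Lemma ffact_leq_exp n k : (n ^_ k <= n ^ k)%N.
Proof.
elim: k => [|k IH]; first by rewrite ffactn0.
by rewrite ffactnSr expnSr leq_mul// leq_subr.
Qed.

(* The product is an explicit bounded bilinear map, since Transf_R(A -> A) carries
   no canonical ring structure; neither [K] nor the norm of [e] need be 1. *)
Section Exponential.
Context {R : realType} {V : completeNormedModType R}.
Context (mul : V -> V -> V) (e : V) (K : R).
Context (mulA : associative mul) (mul1x : left_id e mul) (mulx1 : right_id e mul).
Context (linl : forall a x y z, mul (a *: x + y) z = a *: mul x z + mul y z).
Context (linr : forall a z x y, mul z (a *: x + y) = a *: mul z x + mul z y).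
Context (K_ge0 : 0 <= K) (mul_le : forall x y, `|mul x y| <= K * `|x| * `|y|).

(** * Powers and their growth *)

Definition pw x n := iter n (mul x) e.

Lemma pwS x n : pw x n.+1 = mul x (pw x n). Proof. by []. Qed.

Lemma pwZ a x n : pw (a *: x) n = a ^+ n *: pw x n.
Proof.
elim: n => [|n IH]; first by rewrite expr0 scale1r.
by rewrite !pwS IH (bilinZl linl) (bilinZr linr) scalerA -exprS.
Qed.

Lemma comm_pw x y n : mul x y = mul y x -> mul x (pw y n) = mul (pw y n) x.
Proof.
move=> xy; elim: n => [|n IH]; first by rewrite mul1x mulx1.
by rewrite !pwS mulA xy -mulA IH mulA.
Qed.

Lemma pwM x y n : mul x y = mul y x -> pw (mul x y) n = mul (pw x n) (pw y n).
Proof.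
move=> xy; elim: n => [|n IH]; first by rewrite mul1x.
rewrite !pwS IH -!mulA; congr (mul _ _).
by rewrite !mulA; congr (mul _ _); apply: comm_pw.
Qed.

Lemma norm_pw x n : `|pw x n| <= (K * `|x|) ^+ n * `|e|.
Proof.
elim: n => [|n IH]; first by rewrite expr0 mul1r.
by rewrite pwS (le_trans (mul_le _ _))// exprS -[leRHS]mulrA ler_wpM2l// mulr_ge0.
Qed.

(** Using the unit law on [e] keeps the constant 1. The crude factor [K * |e + x|] could stay above
    1 as [x] tends to 0, and its [n]-th power would then be unbounded. *)
Lemma norm_mul1D x y : `|mul (e + x) y| <= (1 + K * `|x|) * `|y|.
Proof.
rewrite (bilinDl linl) mul1x (le_trans (ler_normD _ _))// mulrDl mul1r.
by rewrite lerD2l.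
Qed.

Lemma norm_pw1D x n : `|pw (e + x) n| <= (1 + K * `|x|) ^+ n * `|e|.
Proof.
elim: n => [|n IH]; first by rewrite expr0 mul1r.
rewrite pwS (le_trans (norm_mul1D _ _))// exprS -mulrA ler_wpM2l//.
by rewrite addr_ge0// mulr_ge0.
Qed.

(* Telescoping: x^(n+1) - y^(n+1) = x (x^n - y^n) + (x - y) y^n *)
Lemma norm_pw1DB x y c n : `|x| <= c -> `|y| <= c ->
  `|pw (e + x) n - pw (e + y) n| <=
    n%:R * (K * `|x - y|) * (1 + K * c) ^+ n * `|e|.
Proof.
move=> xc yc; have c0 : 0 <= c := le_trans (normr_ge0 _) xc.
have le1D (z : V) : `|z| <= c -> 1 + K * `|z| <= 1 + K * c.
  by move=> zc; rewrite lerD2l ler_wpM2l.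
have ge0 : 0 <= 1 + K * c by rewrite addr_ge0// mulr_ge0.
have ge1 : 1 <= 1 + K * c by rewrite lerDl mulr_ge0.
elim: n => [|n IH]; first by rewrite subrr normr0 !mul0r.
have -> : pw (e + x) n.+1 - pw (e + y) n.+1 =
    mul (e + x) (pw (e + x) n - pw (e + y) n) + mul (x - y) (pw (e + y) n).
  rewrite -[in mul (x - y)](addrKA e) [x + e]addrC [_ + y]addrC.
  by rewrite (bilinBr linr) (bilinBl linl) addrA subrK.
rewrite (le_trans (ler_normD _ _))// -natr1 !mulrDl mul1r lerD//.
  rewrite (le_trans (norm_mul1D _ _))//.
  apply: (@le_trans _ _ ((1 + K * c) * `|pw (e + x) n - pw (e + y) n|)).
    by rewrite ler_wpM2r// le1D.
  rewrite (le_trans (ler_wpM2l ge0 IH))//.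
  by rewrite le_eqVlt exprS; apply/orP; left; apply/eqP; ring.
rewrite (le_trans (mul_le _ _))// -[leRHS]mulrA ler_wpM2l ?mulr_ge0//.
rewrite (le_trans (norm_pw1D _ _))// ler_wpM2r//.
apply: (@le_trans _ _ ((1 + K * c) ^+ n)).
  by rewrite lerXn2r ?nnegrE ?le1D// addr_ge0// mulr_ge0.
by rewrite exprS ler_peMl// exprn_ge0.
Qed.

Lemma cvg_pwB (x y : nat -> V) (z : V) :
  (fun n => n%:R *: (x n - e)) @ \oo --> z ->
  (fun n => n%:R *: (y n - e)) @ \oo --> z ->
  (fun n => pw (x n) n - pw (y n) n) @ \oo --> 0.
Proof.
move=> xz yz; apply/norm_cvg0P.
(* Both rescaled sequences converge to [z], so their norms are eventually below [M]; hence [x n - e]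
   and [y n - e] are at most [M / n]. *)
pose M := `|z| + 1.
apply: (@squeeze_cvgr _ _ _ _ (fun=> 0) (fun n =>
  K * `|n%:R *: (x n - e) - n%:R *: (y n - e)| * (expR (K * M) * `|e|))); last 2 first.
- exact: cvg_cst.
- rewrite [X in _ --> X](_ : 0 = K * `|z - z| * (expR (K * M) * `|e|)); last first.
    by rewrite subrr normr0 mulr0 mul0r.
  apply: cvgM; last exact: cvg_cst.
  by apply: cvgM; [exact: cvg_cst|apply: cvg_norm; exact: cvgB].
have bound w : w @ \oo --> z -> \forall n \near \oo, `|w n| <= M :> R.
  move=> /cvg_norm /cvgr_le; apply; by rewrite /M ltrDl.
near=> n; rewrite normr_ge0/=.
have n0 : 0 < n%:R :> R by rewrite ltr0n; near: n; exact: nbhs_infty_gt.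
have le_div (v : V) : `|n%:R *: v| <= M -> `|v| <= M / n%:R.
  by rewrite normrZ (ger0_norm (ltW n0)) ler_pdivlMr// mulrC.
rewrite -[x n](subrKC e) -[y n](subrKC e).
rewrite (le_trans (norm_pw1DB n (le_div _ _) (le_div _ _)))//.
- by near: n; exact: bound.
- by near: n; exact: bound.
rewrite ![e + (_ - e)]subrKC -scalerBr normrZ (ger0_norm (ltW n0)) mulrA.
rewrite [leRHS]mulrA [n%:R * K]mulrC -[K * n%:R * _]mulrA ler_wpM2r//.
rewrite ler_wpM2l// ?mulr_ge0 ?(ltW n0)//.
(* This form turns [expR (K * M)] into an [n]-th power, which dominates [1 + K * (M / n)] to the
   power [n] because [1 + r <= expR r]. *)
have -> : K * M = n%:R * (K * (M / n%:R)).
  by rewrite mulrCA [n%:R * _]mulrC divfK// gt_eqF.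
rewrite expRM_natl lerXn2r ?nnegrE ?expR_ge0 ?expR_ge1Dx//.
by rewrite addr_ge0// !mulr_ge0// ?addr_ge0// invr_ge0 ltW.
Unshelve. all: by end_near. Qed.

(** * The exponential as a series and as a limit of powers *)

Lemma pw1D x n : pw (e + x) n = \sum_(k < n.+1) 'C(n, k)%:R *: pw x k.
Proof.
elim: n => [|n IH]; first by rewrite big_ord1 bin0 scale1r.
rewrite pwS IH (bilinDl linl) mul1x (bilin_sumr linr).
rewrite [RHS]big_ord_recl bin0 [in LHS]big_ord_recl bin0 -addrA; congr (_ + _).
(* Pascal's rule splits the sum in two; the top term of the first half vanishes because
   ['C(n, n.+1) = 0]. *)
under [in RHS]eq_bigr => k _ do rewrite lift0 binS natrD scalerDl.
rewrite big_split/=; congr (_ + _).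
  by rewrite [RHS]big_ord_recr/= bin_small// scale0r addr0.
by apply: eq_bigr => k _; rewrite (bilinZr linr).
Qed.

(** Same shape as [expT], with [pw] matching [powT], so that for [mul] equal to [compT] the two
    agree by conversion. *)
Definition expm x := limn (fun n => \sum_(k < n) (k`!%:R)^-1 *: pw x k).

Lemma le_series_expR (b : R) n : 0 <= b -> \sum_(k < n) b ^+ k / k`!%:R <= expR b.
Proof.
move=> b0; have -> : \sum_(k < n) b ^+ k / k`!%:R = series (exp_coeff b) n.
  by rewrite seriesEord.
apply: nondecreasing_cvgn_le; last exact: is_cvg_series_exp_coeff.
by apply: nondecreasing_series => k _ _; exact: exp_coeff_ge0.
Qed.

Lemma norm_expm_term x k :
  `|(k`!%:R)^-1 *: pw x k| <= (K * `|x|) ^+ k / k`!%:R * `|e|.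
Proof.
rewrite normrZ ger0_norm ?invr_ge0// mulrC [leRHS]mulrAC ler_wpM2r ?invr_ge0//.
exact: norm_pw.
Qed.

Lemma cvg_expm x : (fun n => \sum_(k < n) (k`!%:R)^-1 *: pw x k) @ \oo --> expm x.
Proof.
rewrite /expm.
have -> : (fun n => \sum_(k < n) (k`!%:R)^-1 *: pw x k) =
    series (fun k => (k`!%:R)^-1 *: pw x k) by rewrite seriesEord.
apply: normed_cvg.
apply: (@series_le_cvg _ _ (fun k => (K * `|x|) ^+ k / k`!%:R * `|e|)) => [k|k|k|] /=.
- exact: normr_ge0.
- by rewrite mulr_ge0// divr_ge0// exprn_ge0// mulr_ge0.
- exact: norm_expm_term.
rewrite (_ : (fun k => _ * `|e|) = `|e| *: exp_coeff (K * `|x|)).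
  by apply: is_cvg_seriesZ; exact: is_cvg_series_exp_coeff.
by apply/funext => k /=; rewrite mulrC.
Qed.

(** Without their terms of degree 0 and 1, the series of [expm x] and its scalar majorant compare
    term by term. This second-order estimate yields the value and the derivative of the exponential
    at 0. *)
Lemma norm_expmB x : `|expm x - e - x| <= `|e| * (expR (K * `|x|) - 1 - K * `|x|).
Proof.
have := @cvg_expm x.
move=> /(fun h => cvgB (cvgB h (cvg_cst e)) (cvg_cst x)) /cvg_norm.
move=> /(fun h => ler_cvg_to h (cvg_cst _)); apply.
near=> n.
have [m ->] : exists m, n = m.+2.
  exists n.-2; rewrite -subn2 -addn2 subnK//; near: n; exact: nbhs_infty_ge.
have b0 : 0 <= K * `|x| by rewrite mulr_ge0.
have le_b := le_series_expR m.+2 b0.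
rewrite !big_ord_recl fact0 [_`!]/= !divr1 expr0 expr1 in le_b.
rewrite -[leLHS]/(`|\sum_(k < m.+2) (k`!%:R)^-1 *: pw x k - e - x|).
rewrite !big_ord_recl fact0 [(lift _ _)`!]/= !invr1 !scale1r (_ : pw x ord0 = e)//.
rewrite (_ : pw x (lift _ _) = x) ?[LHS]mulx1//.
rewrite [e + _]addrC addrK [x + _]addrC addrK.
rewrite (le_trans (ler_norm_sum _ _ _))//.
apply: (@le_trans _ _ (`|e| * \sum_(i < m)
    (K * `|x|) ^+ (bump 0 (bump 0 i)) / (bump 0 (bump 0 i))`!%:R)).
  by rewrite mulr_sumr ler_sum// => i _; rewrite mulrC norm_expm_term.
by rewrite ler_wpM2l// -addrA -opprD lerBrDl -addrA.
Unshelve. all: by end_near. Qed.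

Lemma cvg_pw_expm x : (fun n => pw (e + n%:R^-1 *: x) n) @ \oo --> expm x.
Proof.
pose s n := \sum_(k < n) (k`!%:R)^-1 *: pw x k.
(* The partial sum is taken up to degree [n], that of the binomial expansion of the [n]-th power. *)
have sx : (fun n => s n.+1) @ \oo --> expm x.
  by rewrite (cvg_shiftS s); exact: cvg_expm.
rewrite -[expm x]subr0.
have -> : (fun n => pw (e + n%:R^-1 *: x) n) =
    (fun n => s n.+1 - (s n.+1 - pw (e + n%:R^-1 *: x) n)).
  by apply/funext => n; rewrite subKr.
apply: cvgB => //; apply/norm_cvg0P.
pose b := K * `|x|; have b0 : 0 <= b by rewrite mulr_ge0.
apply: (@squeeze_cvgr _ _ _ _ (fun=> 0)
  (fun n => (expR b - (1 + b / n%:R) ^+ n) * `|e|)); last 2 first.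
- exact: cvg_cst.
- rewrite [X in _ --> X](_ : 0 = (expR b - expR b) * `|e|); last first.
    by rewrite subrr mul0r.
  apply: cvgM; last exact: cvg_cst.
  by apply: cvgB; [exact: cvg_cst|exact: cvgn_pow1D_expR].
near=> n; rewrite normr_ge0/=.
have n0 : 0 < n%:R :> R by rewrite ltr0n; near: n; exact: nbhs_infty_gt.
(* [c k] is the gap between the coefficients of [pw x k] in the series and in the binomial
   expansion. It is nonnegative because [n ^_ k <= n ^ k], so norms can be taken termwise without
   absolute values on the coefficients. *)
pose c k : R := (k`!%:R)^-1 - 'C(n, k)%:R / n%:R ^+ k.
have c_ge0 k : 0 <= c k.
  rewrite subr_ge0 ler_pdivrMr ?exprn_gt0// mulrC ler_pdivlMr ?ltr0n ?fact_gt0//.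
  by rewrite -natrM bin_ffact -natrX ler_nat ffact_leq_exp.
have -> : s n.+1 - pw (e + n%:R^-1 *: x) n = \sum_(k < n.+1) c k *: pw x k.
  rewrite pw1D -sumrB; apply: eq_bigr => k _.
  by rewrite pwZ scalerA exprVn scalerBl.
rewrite (le_trans (ler_norm_sum _ _ _))//.
apply: (@le_trans _ _ ((\sum_(k < n.+1) c k * b ^+ k) * `|e|)).
  rewrite mulr_suml ler_sum// => k _.
  by rewrite normrZ ger0_norm// -mulrA ler_wpM2l// norm_pw.
rewrite ler_wpM2r//.
(* The scalar binomial theorem resums the majorant into a truncated exponential minus a power, which
   tends to 0. *)
have -> : \sum_(k < n.+1) c k * b ^+ k =
    \sum_(k < n.+1) b ^+ k / k`!%:R - (1 + b / n%:R) ^+ n.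
  rewrite exprDn -sumrB; apply: eq_bigr => k _.
  rewrite expr1n mul1r mulrBl; congr (_ - _); first by rewrite mulrC.
  by rewrite -[RHS]mulr_natl expr_div_n mulrAC mulrA.
by rewrite lerD2r le_series_expR.
Unshelve. all: by end_near. Qed.

Lemma cvg_pw (x : nat -> V) (y : V) :
  (fun n => n%:R *: (x n - e)) @ \oo --> y ->
  (fun n => pw (x n) n) @ \oo --> expm y.
Proof.
move=> xy.
(* The sequence equals [y] only for [n > 0]; at [n = 0] it is 0. *)
have yy : (fun n : nat => n%:R *: (e + n%:R^-1 *: y - e)) @ \oo --> y.
  apply: cvg_near_cst; near=> n.
  rewrite [e + _]addrC addrK scalerA mulfV ?scale1r// pnatr_eq0 -lt0n.
  by near: n; exact: nbhs_infty_gt.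
rewrite -[expm y]add0r.
have -> : (fun n => pw (x n) n) = (fun n => pw (x n) n -
    pw (e + n%:R^-1 *: y) n + pw (e + n%:R^-1 *: y) n).
  by apply/funext => n; rewrite subrK.
by apply: cvgD; [exact: cvg_pwB yy|exact: cvg_pw_expm].
Unshelve. all: by end_near. Qed.

(** * Group law and differentiability of the exponential *)

Lemma expmD x y : mul x y = mul y x -> expm (x + y) = mul (expm x) (expm y).
Proof.
move=> xy; pose z n := mul (e + n%:R^-1 *: x) (e + n%:R^-1 *: y).
have zM : (fun n => pw (z n) n) @ \oo --> mul (expm x) (expm y).
  have -> : (fun n => pw (z n) n) = (fun n =>
      mul (pw (e + n%:R^-1 *: x) n) (pw (e + n%:R^-1 *: y) n)).
    apply/funext => n; apply: pwM.
    rewrite !(bilinDl linl) !(bilinDr linr) !mul1x !mulx1.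
    by rewrite !(bilinZl linl) !(bilinZr linr) xy addrACA.
  exact: (cvg_bilin linl linr mul_le (@cvg_pw_expm x) (@cvg_pw_expm y)).
apply: cvg_unique zM => //; apply: cvg_pw.
(* The added null term is the limit of [n^-1 *: mul x y], the cross term of [n *: (z n - e)]. *)
have -> : x + y = x + y + 0 *: mul x y by rewrite scale0r addr0.
apply: cvg_trans (cvgD (cvg_cst (x + y)) (cvgZ cvgn_inv (cvg_cst (mul x y)))).
apply: near_eq_cvg; near=> n => /=.
have n0 : n%:R != 0 :> R.
  by rewrite pnatr_eq0 -lt0n; near: n; exact: nbhs_infty_gt.
rewrite /z (bilinDl linl) mul1x (bilinDr linr) mulx1.
rewrite -[e + _ + _]addrA [e + _]addrC addrK (bilinZl linl) (bilinZr linr).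
by rewrite !scalerDr !scalerA mulrA mulfV// mul1r !scale1r addrCA addrA.
Unshelve. all: by end_near. Qed.

Lemma expm0 : expm 0 = e.
Proof.
apply/subr0_eq/eqP; rewrite -[expm 0 - e]subr0 -normr_le0.
by rewrite (le_trans (norm_expmB _))// normr0 mulr0 expR0 subrr subr0 mulr0.
Qed.

(** Multiplying [1 - b <= expR (- b)] by [expR b] gives [expR b - 1 <= b * expR b]; using this twice
    produces the factor [b ^+ 2]. *)
Lemma norm_expmB_le x :
  `|expm x - e - x| <= `|e| * ((K * `|x|) ^+ 2 * expR (K * `|x|)).
Proof.
rewrite (le_trans (norm_expmB _))// ler_wpM2l//.
set b := K * `|x|; have b0 : 0 <= b by rewrite mulr_ge0.
have le1 : expR b - 1 <= b * expR b.
  have := ler_wpM2r (expR_ge0 b) (expR_ge1Dx (- b)).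
  by rewrite -expRD addNr expR0 mulrDl mul1r mulNr; lra.
have := ler_wpM2l b0 le1; rewrite mulrA -expr2; lra.
Qed.

Lemma cvg_expm_slope x : (fun h : R => h^-1 *: (expm (h *: x) - e)) @ 0^' --> x.
Proof.
(* The quadratic bound at [h *: x], divided by [|h|], is at most [|h| * c] once [|h| <= 1], as then
   [expR (|h| * b) <= expR b] for [b = K * |x|]. *)
pose c := `|e| * (K * `|x|) ^+ 2 * expR (K * `|x|).
apply/subr_cvg0/norm_cvg0P.
apply: (@squeeze_cvgr _ _ _ _ (fun=> 0) (fun h : R => `|h| * c)); last 2 first.
- exact: cvg_cst.
- rewrite -[X in _ --> X](mul0r c); apply: cvgM; last exact: cvg_cst.
  by rewrite -[X in _ --> X](normr0 R); apply: cvg_norm; exact: nbhs_dnbhs.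
near=> h; rewrite normr_ge0/=.
have h0 : h != 0 by near: h; exact: nbhs_dnbhs_neq.
have h1 : `|h| <= 1 by near: h; exact: dnbhs0_le.
have -> : h^-1 *: (expm (h *: x) - e) - x = h^-1 *: (expm (h *: x) - e - h *: x).
  by rewrite [RHS]scalerBr scalerA mulVf// scale1r.
rewrite normrZ normfV mulrC ler_pdivrMr ?normr_gt0//.
rewrite (le_trans (norm_expmB_le _))// normrZ.
have -> : K * (`|h| * `|x|) = `|h| * (K * `|x|) by rewrite mulrCA.
set b := K * `|x|; have b0 : 0 <= b by rewrite mulr_ge0.
have -> : `|h| * c * `|h| = `|e| * ((`|h| * b) ^+ 2 * expR b).
  by rewrite /c -/b; ring.
rewrite ler_wpM2l// ler_wpM2l ?exprn_ge0 ?mulr_ge0// ler_expR.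
by rewrite ler_piMl.
Unshelve. all: by end_near. Qed.

(** The group law factors the difference quotient at [t] as the slope at 0 times [expm (t *: x)]. *)
Lemma derivable_expm x t : derivable (fun t : R => expm (t *: x)) t 1.
Proof.
have comm s : mul (s *: x) (t *: x) = mul (t *: x) (s *: x).
  by rewrite !(bilinZl linl) !(bilinZr linr) !scalerA mulrC.
apply: (cvgP (mul x (expm (t *: x)))).
rewrite (_ : (fun h => _) =
    (fun h => mul (h^-1 *: (expm (h *: x) - e)) (expm (t *: x)))).
  exact: (cvg_bilin linl linr mul_le (@cvg_expm_slope x) (cvg_cst _)).
apply/funext => h /=; rewrite [_%:A]mulr1 scalerDl expmD//.
by rewrite (bilinZl linl) (bilinBl linl) mul1x.
Qed.

End Exponential.

(* Joins the existing complete and normed structures on matrices. *)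
HB.instance Definition _ (R : realType) (m n : nat) := Complete.on 'M[R]_(m, n).

(** * Bilinear maps in finite dimension *)

(** Expand both arguments in the standard basis: each coordinate is at most the sup norm, so the
    norms of the images of the basis pairs add up to a valid [K]. *)
Lemma bilin_bounded_rV {R : realType} m n p (B : 'rV[R]_m -> 'rV[R]_n -> 'rV[R]_p) :
  (forall a x y z, B (a *: x + y) z = a *: B x z + B y z) ->
  (forall a z x y, B z (a *: x + y) = a *: B z x + B z y) ->
  exists2 K, 0 <= K & forall x y, `|B x y| <= K * `|x| * `|y|.
Proof.
move=> linl linr.
have coord k (x : 'rV[R]_k) i : `|x 0 i| <= `|x|.
  rewrite [leRHS]/Num.Def.normr/= mx_normrE.
  exact: (le_bigmax _ (fun ij => `|x ij.1 ij.2|) (0, i)).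
exists (\sum_i \sum_j `|B (delta_mx 0 i) (delta_mx 0 j)|).
  by apply: sumr_ge0 => i _; exact: sumr_ge0.
move=> x y; rewrite {1}(row_sum_delta x) {1}(row_sum_delta y).
rewrite (bilin_suml linl) (le_trans (ler_norm_sum _ _ _))// -mulrA mulr_suml.
apply: ler_sum => i _; rewrite (bilin_sumr linr) (le_trans (ler_norm_sum _ _ _))//.
rewrite mulr_suml; apply: ler_sum => j _.
by rewrite (bilinZl linl) (bilinZr linr) scalerA normrZ mulrC ler_wpM2l// normrM ler_pM.
Qed.

(** * Transformations, casts and closure properties *)

Section OPTFacts.
Context {R : realType} (O : OPT R).

(** [attach_state] and [apply_effect] are instances. Arbitrary equations can be destructed, whereas
    [tens_trivr O A] cannot, since [A] occurs on both of its sides. *)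
Definition castT A A1 B B1 (eA : A = A1) (eB : B = B1) (f : TR O A B) : TR O A1 B1 :=
  castmx (erefl 1%N, congr2 (dimT O) eA eB) f.

Lemma transf_castT A A1 B B1 (eA : A = A1) (eB : B = B1) (f : TR O A B) :
  transf O A B f -> transf O A1 B1 (castT eA eB f).
Proof. by case: A1 / eA; case: B1 / eB; rewrite /castT castmx_id. Qed.

Lemma compT_castT A A1 B C C1 (eA : A = A1) (eC : C = C1)
    (g : TR O B C) (f : TR O A B) :
  compT O (castT (erefl B) eC g) (castT eA (erefl B) f) = castT eA eC (compT O g f).
Proof. by case: A1 / eA; case: C1 / eC; rewrite /castT !castmx_id. Qed.

(** Composing the two one-outcome tests gives a one-outcome test on the trivial system; its only
    probability is 1, and [prob] is injective. *)
Lemma deterministic_compT A (u : TR O A (triv O)) (sigma : TR O (triv O) A) :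
  deterministic u -> deterministic sigma -> compT O u sigma = idT O (triv O).
Proof.
move=> u1 s1; apply: (@prob_inj R O); rewrite prob_id.
have [_] := @tests_prob R O _ (@tests_comp R O _ _ _ _ _ s1 u1).
by rewrite /= big_seq1.
Qed.

(** The casts move outside the composite, which the interchange law reduces to [parT] of two
    identities; the remaining cast is the one of [parT_trivr]. *)
Lemma apply_effect_attach_state A A' (u : TR O A' (triv O)) (sigma : TR O (triv O) A') :
  compT O u sigma = idT O (triv O) ->
  compT O (apply_effect A u) (attach_state A sigma) = idT O A.
Proof.
move=> us; rewrite /apply_effect /attach_state.
rewrite [LHS](compT_castT (tens_trivr O A) (tens_trivr O A)).
by rewrite parT_comp us compT_idl; exact: parT_trivr.
Qed.

Lemma transf_apply_effect A A' (u : TR O A' (triv O)) :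
  effect u -> transf O _ _ (apply_effect A u).
Proof. by move=> ?; apply: transf_castT; apply: transf_par => //; exact: transf_id. Qed.

Lemma transf_attach_state A A' (sigma : TR O (triv O) A') :
  state sigma -> transf O _ _ (attach_state A sigma).
Proof. by move=> ?; apply: transf_castT; apply: transf_par => //; exact: transf_id. Qed.

Lemma transf_powT A (T : TR O A A) n : transf O A A T -> transf O A A (powT T n).
Proof.
by move=> TT; elim: n => [|n IH]; [exact: transf_id|exact: transf_comp].
Qed.

Lemma cvg_compT A B C {T : Type} {F : set_system T} {FF : Filter F}
    (g : T -> TR O B C) (f : T -> TR O A B) (y : TR O B C) (x : TR O A B) :
  g @ F --> y -> f @ F --> x -> (fun t => compT O (g t) (f t)) @ F --> compT O y x.
Proof.
have linl := @compT_linl R O A B C; have linr := @compT_linr R O A B C.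
by have [K _ KP] := bilin_bounded_rV linl linr; exact: (cvg_bilin linl linr KP).
Qed.

End OPTFacts.

(** * Limit of repeated collisions *)

Theorem theorem1 (R : realType) (O : OPT R) (A A' : sys O)
    (S : R -> TR O (tens O A A') (tens O A A')) (u : TR O A' (triv O))
    (sigma : TR O (triv O) A') :
  collision_model S u -> state sigma -> deterministic sigma ->
  let C := fun tau : R =>
    compT O (apply_effect A u) (compT O (S tau) (attach_state A sigma)) in
  let G := compT O (apply_effect A u) (compT O (derive1 S 0) (attach_state A sigma)) in
  let U := fun t : R => lim ((fun n : nat => powT (C (t / n%:R)) n) @ \oo) in
  (forall t : R, cvg ((fun n : nat => powT (C (t / n%:R)) n) @ \oo)) /\
  one_param_subgroup U /\
  (forall t : R, U t = expT (t *: G)).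
Proof.
move=> [[Srev [S0 [SD Sder]]] [ueff udet]] sstate sdet C G U.
have linl := @compT_linl R O A A A; have linr := @compT_linr R O A A A.
have [K K0 KP] := bilin_bounded_rV linl linr.
have mulA : associative (@compT R O A A A) by move=> h g f; exact: compTA.
have mul1x : left_id (idT O A) (@compT R O A A A) by exact: compT_idl.
have mulx1 : right_id (idT O A) (@compT R O A A A) by exact: compT_idr.
pose E (X : TR O A A) : TR O A A := expm (@compT R O A A A) (idT O A) X.
have C0 : C 0 = idT O A.
  rewrite /C S0 compT_idl; apply: apply_effect_attach_state.
  exact: deterministic_compT.
have Cn t : (fun n : nat => n%:R *: (C (t / n%:R) - idT O A)) @ \oo --> t *: G.
  (* A collision step depends linearly on the joint transformation. As [L (S 0)] is the identity,
     the increments of [C] are the images under [L] of those of [S]. *)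
  pose L (X : TR O (tens O A A') (tens O A A')) :=
    compT O (apply_effect A u) (compT O X (attach_state A sigma)).
  have LZ a X : L (a *: X) = a *: L X.
    by rewrite /L (bilinZl (@compT_linl _ _ _ _ _)) (bilinZr (@compT_linr _ _ _ _ _)).
  have LB X Y : L (X - Y) = L X - L Y.
    by rewrite /L (bilinBl (@compT_linl _ _ _ _ _)) (bilinBr (@compT_linr _ _ _ _ _)).
  have -> : t *: G = L (t *: derive1 S 0) by rewrite LZ.
  have -> : (fun n : nat => n%:R *: (C (t / n%:R) - idT O A)) =
      (fun n : nat => L (n%:R *: (S (t / n%:R) - S 0))).
    by apply/funext => n; rewrite LZ LB -C0.
  apply: cvg_compT; first exact: cvg_cst.
  apply: cvg_compT; last exact: cvg_cst.
  exact: cvg_derive1_seq (Sder 0).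
have CE t : (fun n : nat => powT (C (t / n%:R)) n) @ \oo --> E (t *: G).
  exact: (cvg_pw mul1x linl linr K0 KP (Cn t)).
have UE t : U t = E (t *: G) by exact: cvg_lim (CE t).
have UD s t : U (s + t) = compT O (U s) (U t).
  rewrite !UE scalerDl; apply: (expmD mulA mul1x mulx1 linl linr K0 KP).
  by rewrite !(bilinZl linl) !(bilinZr linr) !scalerA mulrC.
have U0 : U 0 = idT O A.
  by rewrite UE scale0r; exact: (expm0 mulx1 K0 KP).
have Utr t : transf O A A (U t).
  rewrite UE; apply: closed_cvg (@transf_closed _ O A A) _ _ (CE t).
  apply: nearW => n; apply: transf_powT; apply: transf_comp.
    exact: transf_apply_effect.
  apply: transf_comp; last exact: transf_attach_state.
  by have [] := Srev (t / n%:R).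
split=> [t|]; first exact: cvgP (CE t).
split; last exact: UE.
split=> [t|].
  split; first exact: Utr.
  exists (U (- t)); split; first exact: Utr.
  by rewrite -!UD subrr addNr.
split; first exact: U0.
split; first exact: UD.
move=> t; have -> : U = fun t => E (t *: G) by apply/funext => s; exact: UE.
exact: (derivable_expm mulA mul1x mulx1 linl linr K0 KP).
Qed.
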